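(* Let $r=9$. Then it is not the case that the function $$f(x)=\frac{1-\|x\|}{1-\|x\|^9}$$ is positive definite on $\mathbb{R}^n$ for every $n\ge 1$; that is, there exists an integer $n\ge 1$ such that $f$ is not positive definite on $\mathbb{R}^n$.
   Context: $\|\cdot\|$ is the Euclidean norm on $\mathbb{R}^n$. Convention: when $\|x\|=1$, the quotient is interpreted as its limiting value $1/9$. Definition. A continuous function $h:\mathbb{R}^n\to\mathbb{R}$ is called positive definite if for every $m\ge 1$ and every choice of points $x_1,\dots,x_m\in\mathbb{R}^n$ the $m\times m$ matrix $[h(x_i-x_j)]$ is positive semidefinite. *)

(* Defs.v *)
From HB Require Import structures.
From mathcomp Require Import all_boot all_order all_algebra.
From mathcomp Require Import all_classical all_reals all_analysis.

Set Implicit Arguments.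
Unset Strict Implicit.
Unset Printing Implicit Defensive.

Import Order.TTheory GRing.Theory Num.Theory.
Import numFieldNormedType.Exports.

Local Open Scope ring_scope.

(* R^n is 'rV[R]_n.  Its library norm is the sup norm, so the Euclidean norm
   is defined here; both induce the topology used by [continuous] below. *)
Definition enorm (R : realType) (n : nat) (x : 'rV[R]_n) : R :=
  Num.sqrt (\sum_(i < n) x 0 i ^+ 2).

Definition psdmx (R : realType) (m : nat) (A : 'M[R]_m) : Prop :=
  A^T = A /\ forall v : 'rV[R]_m, 0 <= (v *m A *m v^T) 0 0.

Definition positive_definite (R : realType) (n : nat)
    (h : 'rV[R]_n -> R) : Prop :=
  continuous h /\
  forall (m : nat) (x : 'I_m -> 'rV[R]_n), (1 <= m)%N ->
    psdmx (\matrix_(i < m, j < m) h (x i - x j)).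

Definition norm_quotient (R : realType) (r n : nat) (x : 'rV[R]_n) : R :=
  if enorm x == 1 then r%:R^-1 else (1 - enorm x) / (1 - enorm x ^+ r).

Lemma enorm_continuous (R : realType) (n : nat) :
  continuous (@enorm R n).
Proof.
have sumsq_cts : continuous (fun x : 'rV[R]_n => \sum_(i < n) x 0 i ^+ 2).
  apply: continuous_big => [|i _ x]; first exact: add_continuous.
  apply: (@continuous_comp _ _ _ (fun x : 'rV[R]_n => x 0 i)
    (fun t : R => t ^+ 2)); first exact: coord_continuous.
  exact: exprn_continuous.
move=> x; apply: (@continuous_comp _ _ _
  (fun x : 'rV[R]_n => \sum_(i < n) x 0 i ^+ 2) (@Num.sqrt R)).
  exact: sumsq_cts.
exact: sqrt_continuous.
Qed.

Lemma geom_gt0 (R : realType) (r : nat) (t : R) :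
  (0 < r)%N -> 0 <= t -> 0 < \sum_(i < r) t ^+ i.
Proof.
case: r => // r _ t0; rewrite big_ord_recl expr0 ltr_pwDl ?ltr01//.
by apply: sumr_ge0 => i _; rewrite exprn_ge0.
Qed.

Lemma norm_quotientE (R : realType) (r n : nat) (x : 'rV[R]_n) :
  (0 < r)%N -> norm_quotient r x = (\sum_(i < r) enorm x ^+ i)^-1.
Proof.
move=> r0; rewrite /norm_quotient; case: eqVneq => [->|x1].
  under eq_bigr do rewrite expr1n.
  by rewrite sumr_const card_ord.
have x1' : enorm x - 1 != 0 by rewrite subr_eq0.
rewrite -[1 - _]opprB -[1 - _ ^+ _]opprB invrN mulrNN subrX1 invfM mulrA.
by rewrite divff// mul1r.
Qed.

(* In particular, a failure of [positive_definite] for this function is a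
   failure of the matrix condition. *)
Lemma norm_quotient_continuous (R : realType) (r n : nat) :
  (0 < r)%N -> continuous (@norm_quotient R r n).
Proof.
move=> r0.
have -> : @norm_quotient R r n = fun x => (\sum_(i < r) enorm x ^+ i)^-1.
  by apply/funext => x; rewrite norm_quotientE.
have sum_cts : continuous (fun x : 'rV[R]_n => \sum_(i < r) enorm x ^+ i).
  apply: continuous_big => [|i _ x]; first exact: add_continuous.
  apply: (@continuous_comp _ _ _ (@enorm R n) (fun t : R => t ^+ i)).
    exact: enorm_continuous.
  exact: exprn_continuous.
move=> x; apply: continuousV; last exact: sum_cts.
by rewrite gt_eqF// geom_gt0// sqrtr_ge0.
Qed.

(* Main.v *)
Require Import Defs.
From mathcomp Require Import all_boot all_order all_algebra.
From mathcomp Require Import all_classical all_reals all_analysis.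
From mathcomp Require Import ring lra.

Import Order.TTheory GRing.Theory Num.Theory.

Local Open Scope ring_scope.

(** A radial function that is positive definite in every dimension has much
    room: each point of a finite configuration can be repeated along many
    mutually orthogonal axes.  With N copies, the pairs of points on a common
    axis contribute O(N) to the quadratic form and the pairs on distinct axes
    contribute N (N - 1) times a form that depends only on the norms, so the
    latter form is nonnegative: if [phi] is the radial profile, the kernel
    [phi (sqrt (t_p ^ 2 + t_q ^ 2))] is positive semidefinite
    ([radial_hankel]).  For two points this says that [s |-> phi (sqrt s)] is
    midpoint log-convex ([radial_midpoint_log_convex]), a property which also
    follows from its complete monotonicity in Schoenberg's theorem.

    Here [phi t = 1 / S t] with [S t = 1 + t + ... + t ^ 8], and log-convexity
    would give [S a * S d <= S b ^ 2] whenever [a ^ 2, b ^ 2, d ^ 2] are in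
    arithmetic progression.  This fails for [a, b, d = 7/17, 13/17, 1], since
    [49, 169, 289] is such a progression and [S a * S d] exceeds [S b ^ 2] by
    about two percent. *)

Lemma positive_definite_sum (R : realType) (n : nat) (h : 'rV[R]_n -> R)
    (T : finType) (x : T -> 'rV[R]_n) (c : T -> R) :
  positive_definite h -> 0 <= \sum_p \sum_q c p * c q * h (x p - x q).
Proof.
move=> [_ hpsd]; have [T0|T1] := posnP #|T|.
  by rewrite big1// => p _; have := card0_eq T0 p.
have [_ /(_ (\row_i c (enum_val i)))] := hpsd _ (fun i => x (enum_val i)) T1.
rewrite !mxE; congr (0 <= _).
rewrite [RHS]exchange_big/= [RHS](reindex (@enum_val T T))/=; last first.
  exact/onW_bij/enum_val_bij.
apply: eq_bigr => j _; rewrite !mxE mulr_suml.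
rewrite [RHS](reindex (@enum_val T T))/=; last exact/onW_bij/enum_val_bij.
by apply: eq_bigr => i _; rewrite !mxE mulrAC.
Qed.

Lemma enorm_sub_axes (R : realType) (n : nat) (s t : R) (a b : 'I_n) :
  enorm (s *: delta_mx 0 a - t *: delta_mx 0 b : 'rV[R]_n) =
  if a == b then `|s - t| else Num.sqrt (s ^+ 2 + t ^+ 2).
Proof.
rewrite /enorm; have [->|ab] := eqVneq a b.
  rewrite -scalerBl (bigD1 b)//= big1 ?addr0 => [|i ib].
    by rewrite !mxE !eqxx mulr1 sqrtr_sqr.
  by rewrite !mxE (negPf ib) andbF mulr0 expr0n.
rewrite (bigD1 a)//= (bigD1 b) 1?eq_sym//= big1 ?addr0 => [|i /andP[ia ib]].
  by rewrite !mxE !eqxx (negPf ab) eq_sym (negPf ab) !mulr0 !mulr1 subr0 sub0r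
    sqrrN.
by rewrite !mxE (negPf ia) (negPf ib) !mulr0 subrr expr0n.
Qed.

Lemma slope_ge0 (R : realType) (u v : R) :
  (forall N : nat, 0 <= u + v *+ N) -> 0 <= v.
Proof.
move=> uv; rewrite leNgt; apply/negP => v0.
have u0 : 0 <= u by have := uv 0; rewrite mulr0n addr0.
have v0' : 0 < - v by rewrite oppr_gt0.
have := archi_boundP (divr_ge0 u0 (ltW v0')).
rewrite ltr_pdivrMr// mulr_natl mulNrn -subr_gt0 -opprD oppr_gt0 addrC.
by rewrite ltNge uv.
Qed.

(** The points are the vectors [t p e_a], with [p] in [T] and [a] among [N + 1]
    coordinate axes, with weight [c p].  The blocks with equal axes give [D],
    the others give [E], so the whole form is [(N + 1) (D + N E)]. *)
Lemma radial_hankel (R : realType) (phi : R -> R) (T : finType)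
    (t c : T -> R) :
  (forall n, (1 <= n)%N ->
    positive_definite (fun x : 'rV[R]_n => phi (enorm x))) ->
  0 <= \sum_p \sum_q c p * c q * phi (Num.sqrt (t p ^+ 2 + t q ^+ 2)).
Proof.
move=> phi_pd.
set E := \sum_p _; set D := \sum_p \sum_q c p * c q * phi `|t p - t q|.
apply: (@slope_ge0 _ D) => N.
have := @positive_definite_sum R N.+1 _ ('I_N.+1 * T)%type
  (fun ap => t ap.2 *: delta_mx 0 ap.1) (fun ap => c ap.2) (phi_pd N.+1 isT).
have -> : \sum_(p : 'I_N.+1 * T) \sum_(q : 'I_N.+1 * T)
    c p.2 * c q.2 * phi (enorm (t p.2 *: delta_mx 0 p.1
                                - t q.2 *: delta_mx 0 q.1 : 'rV_N.+1)) =
    \sum_(a < N.+1) \sum_(b < N.+1) if a == b then D else E.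
  rewrite -(pair_bigA _ (fun a p => \sum_(q : 'I_N.+1 * T)
    c p * c q.2 * phi (enorm (t p *: delta_mx 0 a
                                - t q.2 *: delta_mx 0 q.1 : 'rV_N.+1))))/=.
  apply: eq_bigr => a _; under eq_bigr => p _.
    rewrite -(pair_bigA _ (fun b q => c p * c q * phi (enorm
      (t p *: delta_mx 0 a - t q *: delta_mx 0 b : 'rV_N.+1))))/=.
    over.
  rewrite exchange_big/=; apply: eq_bigr => b _.
  case: ifP => ab; apply: eq_bigr => p _; apply: eq_bigr => q _;
    by rewrite enorm_sub_axes ab.
have -> : \sum_(a < N.+1) \sum_(b < N.+1) (if a == b then D else E) =
    (D + E *+ N) *+ N.+1.
  rewrite -[X in _ *+ X]card_ord -sumr_const; apply: eq_bigr => a _.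
  rewrite (bigD1 a)//= eqxx; congr (_ + _).
  rewrite (eq_bigr (fun=> E)) => [|b ba]; last by rewrite eq_sym (negPf ba).
  by rewrite sumr_const cardC1 card_ord.
by rewrite pmulrn_lge0.
Qed.

(** The 2 x 2 case of [radial_hankel]: with [t = a / sqrt 2, d / sqrt 2], the
    matrix is [[phi a, phi b], [phi b, phi d]], and its determinant is
    nonnegative. *)
Lemma radial_midpoint_log_convex (R : realType) (phi : R -> R) (a b d : R) :
  (forall n, (1 <= n)%N ->
    positive_definite (fun x : 'rV[R]_n => phi (enorm x))) ->
  0 <= a -> 0 <= b -> 0 <= d -> b ^+ 2 *+ 2 = a ^+ 2 + d ^+ 2 ->
  0 < phi a -> phi b ^+ 2 <= phi a * phi d.
Proof.
move=> phi_pd a0 b0 d0 abd phia.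
have sq2 (x : R) : (x / Num.sqrt 2) ^+ 2 = x ^+ 2 / 2.
  by rewrite expr_div_n sqr_sqrtr.
(* The vector (phi b, - phi a) gives phi a times the determinant. *)
have := @radial_hankel _ phi bool
  (fun p => (if p then a else d) / Num.sqrt 2)
  (fun p => if p then phi b else - phi a) phi_pd.
rewrite !big_bool/= !sq2.
have -> : a ^+ 2 / 2 + a ^+ 2 / 2 = a ^+ 2 by field.
have -> : d ^+ 2 / 2 + d ^+ 2 / 2 = d ^+ 2 by field.
have -> : a ^+ 2 / 2 + d ^+ 2 / 2 = b ^+ 2 by lra.
have -> : d ^+ 2 / 2 + a ^+ 2 / 2 = b ^+ 2 by lra.
rewrite !sqrtr_sqr !ger0_norm// => H.
rewrite -subr_ge0 -(pmulr_rge0 _ phia); apply: le_trans H _.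
by rewrite le_eqVlt; apply/orP; left; apply/eqP; ring.
Qed.

Theorem mainTheorem5 (R : realType) :
  exists n : nat, (1 <= n)%N /\
    ~ positive_definite (fun x : 'rV[R]_n => norm_quotient 9 x).
Proof.
apply: contrapT => no_n.
pose S (t : R) := \sum_(i < 9) t ^+ i.
have S_pd n : (1 <= n)%N ->
    positive_definite (fun x : 'rV[R]_n => (S (enorm x))^-1).
  move=> n1; have -> : (fun x : 'rV[R]_n => (S (enorm x))^-1) =
      fun x => norm_quotient 9 x.
    by apply/funext => x; rewrite norm_quotientE.
  by apply: contrapT => npd; apply: no_n; exists n.
have S0 (t : R) : 0 <= t -> 0 < S t by exact: geom_gt0.
have a0 : 0 <= 7 / 17 :> R by lra.
have b0 : 0 <= 13 / 17 :> R by lra.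
have ap : (13 / 17) ^+ 2 *+ 2 = (7 / 17) ^+ 2 + 1 ^+ 2 :> R by field.
have phia : 0 < (S (7 / 17))^-1 by rewrite invr_gt0 S0.
have := @radial_midpoint_log_convex R (fun t => (S t)^-1)
  _ _ _ S_pd a0 b0 ler01 ap phia.
have -> : S 1 = 9.
  by rewrite /S; under eq_bigr do rewrite expr1n; rewrite sumr_const card_ord.
rewrite exprVn -invfM lef_pV2 ?posrE ?exprn_gt0 ?mulr_gt0 ?S0//.
rewrite leNgt => /negP; apply.
rewrite /S !big_ord_recr !big_ord0/=.
lra.
Qed.
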